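(* Every natural deduction theory, with classifier $p:\mathbb P\to\mathbf{ctx}$ and entailment classifier $e:\mathbb E\to\mathbf{ctx}$, generates the structural rules of Hypothesis, Swap, Contraction, Weakening and Cut. Precisely, writing objects of $\mathbb E$ over $x$ as vertical arrows $\gamma\to\phi$ of $\mathbb P$ over $x$: (H) for all $\gamma,\phi\in\mathbb P$ over $x$, there is an object $\gamma\wedge\phi\to\phi$ of $\mathbb E$; and the rules $\mathscr R$ of the theory contain functors realizing (Sw) $(\gamma,\delta,\ \gamma\wedge\delta\to\phi)\mapsto(\delta,\gamma,\ \delta\wedge\gamma\to\phi)$; (C) $(\gamma,\psi,\ \gamma\wedge\psi\wedge\psi\to\phi)\mapsto(\gamma,\psi,\ \gamma\wedge\psi\to\phi)$; (W) $(\gamma\to\phi,\ \psi)\mapsto(\gamma\wedge\psi\to\phi)$, for $\psi\in\mathbb P$ over the same $x$; (Cut) $(\gamma\to\phi,\ \gamma\wedge\phi\to\psi)\mapsto(\gamma\to\psi)$, where all data lie over the same object $x$ of $\mathbf{ctx}$ and the domains are the evident categories of such tuples, obtained as finite limits from $\mathbb P$, $\mathbb E$, $\wedge$ and the domain and codomain functors $d,c:\mathbb E\to\mathbb P$.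
   Context: Judgemental theory: a category $\mathbf{ctx}$ with terminal object, a set $\mathscr R$ of functors (''rules''), of which those with codomain $\mathbf{ctx}$ are the ''judgements'' $\mathscr J$, and a set $\mathscr P$ of natural transformations (''policies'') filling triangles of rules, such that: $\mathscr R,\mathscr P$ are closed under composition and under finite limits (pullbacks, equalizers, finite powers $\mathcal X^n$ and arrow categories $\mathcal X^{\mathsf 2}$ with $\mathrm{dom},\mathrm{cod}$ and the tautological transformation $\mathrm{dom}\Rightarrow\mathrm{cod}$; projections and functors induced by the universal properties from cones made of rules (and policies) are again in $\mathscr R$), $\mathscr P$ is closed under whiskering with rules, and the theory is closed under $\sharp$-liftings: given rules $\lambda:\mathcal F\to\mathcal G$, $r:\mathcal F\to\mathcal X$, $r':\mathcal G\to\mathcal X$, a policy $\lambda^\sharp:r'\lambda\Rightarrow r$ and a rule $h:\mathcal H\to\mathcal X$ which is a fibration, the functor $\mathcal F\times_{\mathcal X}\mathcal H\to\mathcal G\times_{\mathcal X}\mathcal H$, $(F,H)\mapsto(\lambda F,H[\lambda^\sharp_F])$ is in $\mathscr R$, and the natural transformation with components the cartesian lifts $H[\lambda^\sharp_F]\to H$ is in $\mathscr P$ (and dually for opfibrations). Natural deduction theory (NDT): the judgemental theory generated by one classifier $p:\mathbb P\to\mathbf{ctx}$, where $\mathbf{ctx}$ is the category of finite sets and $p$ is a faithful fibration (whose fibers are regarded as posets) with fibered finite products $\wedge$, fibered implication and fibered initial objects; these operators and the natural maps attached to their universal properties (projections, pairings) are counted in the theory. It is required to be substitutional: judgement classifiers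 are fibrations, rules preserve cartesian maps, policies have cartesian components. Entailment classifier: let $I:\mathbf{ctx}\to\mathbf{ctx}^{\mathsf 2}$, $x\mapsto\mathrm{id}_x$; $\mathbb E$ is the pullback of $p^{\mathsf 2}:\mathbb P^{\mathsf 2}\to\mathbf{ctx}^{\mathsf 2}$ along $I$, i.e. the category of $p$-vertical arrows, with projection $e:\mathbb E\to\mathbf{ctx}$. The sequent $x;\Gamma\vdash\phi$ means that there is an object $\gamma\to\phi$ of $\mathbb E$ over $x$, where $\gamma$ is the product of the finite list $\Gamma$ of formulas over $x$, and a comma on the left of $\vdash$ is interpreted as $\wedge$. *)

(* Defs.v *)
From mathcomp Require Import all_boot.
From Stdlib Require Import FunctionalExtensionality ProofIrrelevance.

Set Implicit Arguments.
Unset Strict Implicit.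
Unset Printing Implicit Defensive.

Declare Scope cat_scope.
Delimit Scope cat_scope with cat.
Local Open Scope cat_scope.

Record Category := MkCategory {
  Ob :> Type;
  Hom : Ob -> Ob -> Type;
  idm : forall a, Hom a a;
  comp : forall a b c, Hom b c -> Hom a b -> Hom a c;
  comp_idl : forall a b (f : Hom a b), comp (idm b) f = f;
  comp_idr : forall a b (f : Hom a b), comp f (idm a) = f;
  comp_assoc : forall a b c d (h : Hom c d) (g : Hom b c) (f : Hom a b),
    comp h (comp g f) = comp (comp h g) f }.
Arguments Hom {C} a b : rename.
Arguments idm {C} a : rename.
Arguments comp {_ a b c} g f : rename.
Notation "g ∘ f" := (comp g f) (at level 40, left associativity) : cat_scope.

Record Functor (C D : Category) := MkFunctor {
  fob :> C -> D;
  fmap : forall a b, Hom a b -> Hom (fob a) (fob b);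
  fmap_id : forall a, fmap (idm a) = idm (fob a);
  fmap_comp : forall a b c (g : Hom b c) (f : Hom a b),
    fmap (g ∘ f) = fmap g ∘ fmap f }.
Arguments fmap {C D} F {a b} f : rename.

Record NatTrans (C D : Category) (F G : Functor C D) := MkNatTrans {
  ntc :> forall a, Hom (F a) (G a);
  nt_natural : forall a b (f : Hom a b), ntc b ∘ fmap F f = fmap G f ∘ ntc a }.
Arguments ntc {C D F G} t a : rename.

Definition fid (C : Category) : Functor C C :=
  @MkFunctor C C (fun a => a) (fun _ _ f => f)
    (fun _ => erefl) (fun _ _ _ _ _ => erefl).

Program Definition fcomp (A B C : Category) (G : Functor B C) (F : Functor A B)
    : Functor A C :=
  @MkFunctor A C (fun a => G (F a)) (fun _ _ f => fmap G (fmap F f)) _ _.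
Next Obligation. by move=> A B C G F a /=; rewrite !fmap_id. Qed.
Next Obligation. by move=> A B C G F a b c g f /=; rewrite !fmap_comp. Qed.
Notation "G \oF F" := (fcomp G F) (at level 50, left associativity) : cat_scope.

Program Definition nt_id (C D : Category) (F : Functor C D) : NatTrans F F :=
  @MkNatTrans C D F F (fun a => idm (F a)) _.
Next Obligation. by move=> C D F a b f /=; rewrite comp_idl comp_idr. Qed.

Program Definition nt_comp (C D : Category) (F G H : Functor C D)
    (t : NatTrans G H) (s : NatTrans F G) : NatTrans F H :=
  @MkNatTrans C D F H (fun a => t a ∘ s a) _.
Next Obligation.
move=> C D F G H t s a b f /=.
by rewrite -comp_assoc nt_natural comp_assoc nt_natural comp_assoc.
Qed.

Program Definition whiskL (B C D : Category) (H : Functor C D)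
    (F G : Functor B C) (t : NatTrans F G) : NatTrans (H \oF F) (H \oF G) :=
  @MkNatTrans B D (H \oF F) (H \oF G) (fun a => fmap H (t a)) _.
Next Obligation.
by move=> B C D H F G t a b f /=; rewrite -!fmap_comp nt_natural.
Qed.

Program Definition whiskR (B C D : Category) (F G : Functor C D)
    (t : NatTrans F G) (K : Functor B C) : NatTrans (F \oF K) (G \oF K) :=
  @MkNatTrans B D (F \oF K) (G \oF K) (fun a => t (K a)) _.
Next Obligation. by move=> B C D F G t K a b f /=; rewrite nt_natural. Qed.

(* Limits of categories are taken strictly, so arrows with provably equal
   endpoints must be compared: [eqhom f g] is equality in the type of all
   arrows of [C], and in particular forces the endpoints to be equal. *)

Record Arrow (C : Category) := MkArrow {
  asrc : C; atgt : C; amor : Hom asrc atgt }.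

Definition eqhom (C : Category) (a b a' b' : C) (f : Hom a b) (g : Hom a' b')
  : Prop := MkArrow f = MkArrow g.

Lemma eqhom_eq (C : Category) (a b : C) (f g : Hom a b) : eqhom f g -> f = g.
Proof.
move=> e.
have tr : forall u : Arrow C, MkArrow f = u ->
    forall (ea : a = asrc u) (eb : b = atgt u),
    eq_rect b (fun y => Hom (asrc u) y)
      (eq_rect a (fun x => Hom x b) f (asrc u) ea) (atgt u) eb = amor u.
  move=> u <- /= ea eb.
  by rewrite (proof_irrelevance _ ea erefl) (proof_irrelevance _ eb erefl).
exact: (tr _ e erefl erefl).
Qed.

Lemma eqhom_id (C : Category) (a b : C) : a = b -> eqhom (idm a) (idm b).
Proof. by move=> ->. Qed.

Lemma eqhom_comp (C : Category) (a b c a' b' c' : C)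
    (g : Hom b c) (f : Hom a b) (g' : Hom b' c') (f' : Hom a' b') :
  eqhom g g' -> eqhom f f' -> eqhom (g ∘ f) (g' ∘ f').
Proof.
move=> eg ef.
have ea : a = a' by exact: (f_equal (@asrc C) ef).
have eb : b = b' by exact: (f_equal (@asrc C) eg).
have ec : c = c' by exact: (f_equal (@atgt C) eg).
subst a' b' c'.
by rewrite (eqhom_eq eg) (eqhom_eq ef).
Qed.

Lemma eqhom_fmap (C D : Category) (F : Functor C D) (a b a' b' : C)
    (f : Hom a b) (f' : Hom a' b') :
  eqhom f f' -> eqhom (fmap F f) (fmap F f').
Proof.
exact: (f_equal (fun u : Arrow C => MkArrow (fmap F (amor u)))).
Qed.

Definition Feq (C D : Category) (F G : Functor C D) : Prop :=
  forall (a b : C) (f : Hom a b), eqhom (fmap F f) (fmap G f).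
Notation "F =F G" := (Feq F G) (at level 70, no associativity) : cat_scope.

Lemma Feq_ob (C D : Category) (F G : Functor C D) :
  F =F G -> forall a, F a = G a.
Proof. by move=> e a; exact: (f_equal (@asrc D) (e a a (idm a))). Qed.

Lemma sig_eq (T : Type) (Q : T -> Prop) (x y : sig Q) :
  sval x = sval y -> x = y.
Proof.
case: x y => [x hx] [y hy] /= e; subst y.
by rewrite (proof_irrelevance _ hx hy).
Qed.

Section Pullback.
Variables (A B X : Category) (F : Functor A X) (G : Functor B X).

Record PbOb := MkPbOb { pb1 : A; pb2 : B; pb_eq : F pb1 = G pb2 }.

Definition PbHom (z w : PbOb) : Type :=
  {uv : Hom (pb1 z) (pb1 w) * Hom (pb2 z) (pb2 w)
    | eqhom (fmap F uv.1) (fmap G uv.2)}.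

Program Definition Pullback : Category :=
  @MkCategory PbOb PbHom
    (fun z => exist _ (idm (pb1 z), idm (pb2 z)) _)
    (fun _ _ _ s t =>
       exist _ ((sval s).1 ∘ (sval t).1, (sval s).2 ∘ (sval t).2) _)
    _ _ _.
Next Obligation. by move=> z /=; rewrite !fmap_id; apply/eqhom_id/pb_eq. Qed.
Next Obligation.
move=> a b c [s hs] [t ht] /=; rewrite !fmap_comp; exact: eqhom_comp.
Qed.
Next Obligation.
by move=> a b [[u v] h]; apply: sig_eq; rewrite /= !comp_idl.
Qed.
Next Obligation.
by move=> a b [[u v] h]; apply: sig_eq; rewrite /= !comp_idr.
Qed.
Next Obligation.
by move=> a b c d h g f; apply: sig_eq; rewrite /= !comp_assoc.
Qed.

Definition pbpr1 : Functor Pullback A :=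
  @MkFunctor Pullback A pb1 (fun _ _ s => (sval s).1)
    (fun _ => erefl) (fun _ _ _ _ _ => erefl).

Definition pbpr2 : Functor Pullback B :=
  @MkFunctor Pullback B pb2 (fun _ _ s => (sval s).2)
    (fun _ => erefl) (fun _ _ _ _ _ => erefl).

Lemma pb_square : F \oF pbpr1 =F G \oF pbpr2.
Proof. by move=> a b [uv h]; exact: h. Qed.

Program Definition pb_pair (Q : Category) (U : Functor Q A) (V : Functor Q B)
    (h : F \oF U =F G \oF V) : Functor Q Pullback :=
  @MkFunctor Q Pullback (fun q => MkPbOb (Feq_ob h q))
    (fun a b f => exist _ (fmap U f, fmap V f) (h a b f)) _ _.
Next Obligation. by move=> Q U V h a; apply: sig_eq; rewrite /= !fmap_id. Qed.
Next Obligation.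
by move=> Q U V h a b c g f; apply: sig_eq; rewrite /= !fmap_comp.
Qed.

End Pullback.

Arguments MkPbOb {A B X F G} pb1 pb2 pb_eq.
Arguments pbpr1 {A B X F G}.
Arguments pbpr2 {A B X F G}.
Arguments pb_pair {A B X F G Q} U V h.

Section Equalizer.
Variables (A B : Category) (F G : Functor A B).

Record EqOb := MkEqOb { eq1 : A; eq_eq : F eq1 = G eq1 }.

Program Definition Equalizer : Category :=
  @MkCategory EqOb
    (fun z w => {u : Hom (eq1 z) (eq1 w) | eqhom (fmap F u) (fmap G u)})
    (fun z => exist _ (idm (eq1 z)) _)
    (fun _ _ _ s t => exist _ (sval s ∘ sval t) _)
    _ _ _.
Next Obligation. by move=> z /=; rewrite !fmap_id; apply/eqhom_id/eq_eq. Qed.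
Next Obligation.
move=> a b c [s hs] [t ht] /=; rewrite !fmap_comp; exact: eqhom_comp.
Qed.
Next Obligation. by move=> a b [u h]; apply: sig_eq; rewrite /= comp_idl. Qed.
Next Obligation. by move=> a b [u h]; apply: sig_eq; rewrite /= comp_idr. Qed.
Next Obligation.
by move=> a b c d h g f; apply: sig_eq; rewrite /= comp_assoc.
Qed.

Definition eqincl : Functor Equalizer A :=
  @MkFunctor Equalizer A eq1 (fun _ _ s => sval s)
    (fun _ => erefl) (fun _ _ _ _ _ => erefl).

End Equalizer.

Arguments eqincl {A B F G}.

Section Power.
Variables (n : nat) (X : Category).

Program Definition Power : Category :=
  @MkCategory ('I_n -> X) (fun a b => forall i, Hom (a i) (b i))
    (fun a i => idm (a i)) (fun _ _ _ g f i => g i ∘ f i) _ _ _.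
Next Obligation.
by move=> a b f; apply: functional_extensionality_dep => i; rewrite comp_idl.
Qed.
Next Obligation.
by move=> a b f; apply: functional_extensionality_dep => i; rewrite comp_idr.
Qed.
Next Obligation.
by move=> a b c d h g f; apply: functional_extensionality_dep => i;
   rewrite comp_assoc.
Qed.

Definition powpr (i : 'I_n) : Functor Power X :=
  @MkFunctor Power X (fun a => a i) (fun _ _ f => f i)
    (fun _ => erefl) (fun _ _ _ _ _ => erefl).

End Power.

Arguments powpr {n X} i.

Section ArrowCategory.
Variable X : Category.

Program Definition ArrowCat : Category :=
  @MkCategory (Arrow X)
    (fun f g => {uv : Hom (asrc f) (asrc g) * Hom (atgt f) (atgt g)
                  | uv.2 ∘ amor f = amor g ∘ uv.1})
    (fun f => exist _ (idm (asrc f), idm (atgt f)) _)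
    (fun _ _ _ s t =>
       exist _ ((sval s).1 ∘ (sval t).1, (sval s).2 ∘ (sval t).2) _)
    _ _ _.
Next Obligation. by move=> f /=; rewrite comp_idl comp_idr. Qed.
Next Obligation.
move=> a b c [s hs] [t ht] /=.
by rewrite -comp_assoc ht comp_assoc hs comp_assoc.
Qed.
Next Obligation.
by move=> a b [[u v] h]; apply: sig_eq; rewrite /= !comp_idl.
Qed.
Next Obligation.
by move=> a b [[u v] h]; apply: sig_eq; rewrite /= !comp_idr.
Qed.
Next Obligation.
by move=> a b c d h g f; apply: sig_eq; rewrite /= !comp_assoc.
Qed.

Definition adom : Functor ArrowCat X :=
  @MkFunctor ArrowCat X (@asrc X) (fun _ _ s => (sval s).1)
    (fun _ => erefl) (fun _ _ _ _ _ => erefl).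

Definition acod : Functor ArrowCat X :=
  @MkFunctor ArrowCat X (@atgt X) (fun _ _ s => (sval s).2)
    (fun _ => erefl) (fun _ _ _ _ _ => erefl).

Program Definition ataut : NatTrans adom acod :=
  @MkNatTrans ArrowCat X adom acod (@amor X) _.
Next Obligation. by move=> a b [[u v] h] /=; rewrite /= in h. Qed.

Program Definition idarr : Functor X ArrowCat :=
  @MkFunctor X ArrowCat (fun x => MkArrow (idm x))
    (fun _ _ f => exist _ (f, f) _) _ _.
Next Obligation. by move=> a b f /=; rewrite comp_idl comp_idr. Qed.
Next Obligation. by move=> a; apply: sig_eq. Qed.
Next Obligation. by move=> a b c g f; apply: sig_eq. Qed.

End ArrowCategory.

Arguments adom {X}.
Arguments acod {X}.
Arguments ataut {X}.

Program Definition arrmap (X Y : Category) (F : Functor X Y)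
    : Functor (ArrowCat X) (ArrowCat Y) :=
  @MkFunctor (ArrowCat X) (ArrowCat Y)
    (fun f => MkArrow (fmap F (amor f)))
    (fun _ _ s => exist _ (fmap F (sval s).1, fmap F (sval s).2) _) _ _.
Next Obligation. by move=> X Y F a b [[u v] /= h]; rewrite -!fmap_comp h. Qed.
Next Obligation. by move=> X Y F a; apply: sig_eq; rewrite /= !fmap_id. Qed.
Next Obligation.
by move=> X Y F a b c g f; apply: sig_eq; rewrite /= !fmap_comp.
Qed.

Section Fibrations.
Variables (E B : Category) (p : Functor E B).

Definition cartesian (a b : E) (g : Hom a b) : Prop :=
  forall (c : E) (h : Hom c b) (w : Hom (p c) (p a)),
    fmap p g ∘ w = fmap p h ->
    exists! k : Hom c a, fmap p k = w /\ g ∘ k = h.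

Definition opcartesian (a b : E) (g : Hom a b) : Prop :=
  forall (c : E) (h : Hom a c) (w : Hom (p b) (p c)),
    w ∘ fmap p g = fmap p h ->
    exists! k : Hom b c, fmap p k = w /\ k ∘ g = h.

Definition fibration : Prop :=
  forall (b : E) (x : B) (f : Hom x (p b)),
    exists (a : E) (g : Hom a b), eqhom (fmap p g) f /\ cartesian g.

Definition opfibration : Prop :=
  forall (a : E) (x : B) (f : Hom (p a) x),
    exists (b : E) (g : Hom a b), eqhom (fmap p g) f /\ opcartesian g.

Definition faithful : Prop :=
  forall (a b : E) (f g : Hom a b), fmap p f = fmap p g -> f = g.

Definition vertical (a b : E) (f : Hom a b) : Prop :=
  eqhom (fmap p f) (idm (p a)).

Definition vertical_nt (Q : Category) (F G : Functor Q E) (t : NatTrans F G)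
  : Prop := forall q, vertical (t q).

(* The order of the fibres of [p]; in particular [p a = p b]. *)
Definition fibre_le (a b : E) : Prop := exists f : Hom a b, vertical f.

Lemma cartesian_id (a : E) : cartesian (idm a).
Proof.
move=> c h w; rewrite fmap_id comp_idl => ->.
exists h; split; first by rewrite comp_idl.
by move=> k [_ <-]; rewrite comp_idl.
Qed.

Lemma cartesian_comp (a b c : E) (g : Hom b c) (f : Hom a b) :
  cartesian g -> cartesian f -> cartesian (g ∘ f).
Proof.
move=> cg cf d h w; rewrite fmap_comp -comp_assoc => /cg [k [[pk gk] uk]].
have [l [[pl fl] ul]] := cf _ _ _ (esym pk).
exists l; split; first by rewrite -comp_assoc fl.
move=> l' [pl' gl']; apply: ul; split=> //.
by apply/esym/uk; rewrite fmap_comp pl' comp_assoc.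
Qed.

(* Objects of [E] with cartesian arrows between them. *)
Program Definition Cart : Category :=
  @MkCategory (Ob E) (fun a b => {f : Hom a b | cartesian f})
    (fun a => exist _ (idm a) (@cartesian_id a))
    (fun _ _ _ g f =>
       exist _ (sval g ∘ sval f) (cartesian_comp (svalP g) (svalP f)))
    _ _ _.
Next Obligation. by move=> a b [u h]; apply: sig_eq; rewrite /= comp_idl. Qed.
Next Obligation. by move=> a b [u h]; apply: sig_eq; rewrite /= comp_idr. Qed.
Next Obligation.
by move=> a b c d h g f; apply: sig_eq; rewrite /= comp_assoc.
Qed.

Definition cart_incl : Functor Cart E :=
  @MkFunctor Cart E (fun a => a) (fun _ _ f => sval f)
    (fun _ => erefl) (fun _ _ _ _ _ => erefl).

End Fibrations.

Definition preserves_cartesian (E E' B : Category)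
    (p : Functor E B) (p' : Functor E' B) (F : Functor E E') : Prop :=
  forall (a b : E) (f : Hom a b), cartesian p f -> cartesian p' (fmap F f).

Definition has_terminal (C : Category) : Prop :=
  exists t : C, forall a : C, exists! f : Hom a t, True.

(* Every functor into a limit is the one induced by its cone of projections, so
   closure under induced functors reads: if the projections of [U] are rules
   then [U] is a rule.  Likewise for natural transformations. *)
Record JudgementalTheory (ctx : Category) := MkJudgementalTheory {
  rule : forall C D : Category, Functor C D -> Prop;
  policy : forall (C D : Category) (F G : Functor C D), NatTrans F G -> Prop;

  jt_terminal : has_terminal ctx;

  policy_rules : forall C D (F G : Functor C D) (t : NatTrans F G),
    policy t -> rule F /\ rule G;

  rule_id : forall C D (F : Functor C D), rule F -> rule (fid C) /\ rule (fid D);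
  rule_comp : forall A B C (G : Functor B C) (F : Functor A B),
    rule G -> rule F -> rule (G \oF F);
  policy_id : forall C D (F : Functor C D), rule F -> policy (nt_id F);
  policy_comp : forall C D (F G H : Functor C D)
      (t : NatTrans G H) (s : NatTrans F G),
    policy t -> policy s -> policy (nt_comp t s);
  policy_whiskL : forall B C D (H : Functor C D) (F G : Functor B C)
      (t : NatTrans F G),
    rule H -> policy t -> policy (whiskL H t);
  policy_whiskR : forall B C D (F G : Functor C D) (t : NatTrans F G)
      (K : Functor B C),
    policy t -> rule K -> policy (whiskR t K);

  pb_proj : forall A B X (F : Functor A X) (G : Functor B X),
    rule F -> rule G ->
    rule (@pbpr1 A B X F G) /\ rule (@pbpr2 A B X F G);
  pb_ind : forall A B X (F : Functor A X) (G : Functor B X) Q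
      (U : Functor Q (Pullback F G)),
    rule F -> rule G -> rule (pbpr1 \oF U) -> rule (pbpr2 \oF U) -> rule U;
  pb_ind2 : forall A B X (F : Functor A X) (G : Functor B X) Q
      (U V : Functor Q (Pullback F G)) (t : NatTrans U V),
    rule F -> rule G ->
    policy (whiskL pbpr1 t) -> policy (whiskL pbpr2 t) -> policy t;

  eq_proj : forall A B (F G : Functor A B),
    rule F -> rule G -> rule (@eqincl A B F G);
  eq_ind1 : forall A B (F G : Functor A B) Q (U : Functor Q (Equalizer F G)),
    rule F -> rule G -> rule (eqincl \oF U) -> rule U;
  eq_ind2 : forall A B (F G : Functor A B) Q
      (U V : Functor Q (Equalizer F G)) (t : NatTrans U V),
    rule F -> rule G -> policy (whiskL eqincl t) -> policy t;

  (* [rule (fid X)] says that the category [X] belongs to the theory; this is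
     needed for the powers [X^0], which have no projections. *)
  pow_proj : forall n X (i : 'I_n), rule (fid X) -> rule (@powpr n X i);
  pow_ind : forall n X Q (U : Functor Q (Power n X)),
    rule (fid X) -> rule (fid Q) ->
    (forall i, rule (powpr i \oF U)) -> rule U;
  pow_ind2 : forall n X Q (U V : Functor Q (Power n X)) (t : NatTrans U V),
    rule U -> rule V ->
    (forall i, policy (whiskL (powpr i) t)) -> policy t;

  arr_proj : forall X, rule (fid X) -> rule (@adom X) /\ rule (@acod X);
  arr_taut : forall X, rule (fid X) -> policy (@ataut X);
  arr_ind : forall X Q (U : Functor Q (ArrowCat X)),
    policy (whiskR ataut U) -> rule U;
  arr_ind2 : forall X Q (U V : Functor Q (ArrowCat X)) (t : NatTrans U V),
    rule U -> rule V ->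
    policy (whiskL adom t) -> policy (whiskL acod t) -> policy t;

  (* Fibrations carry no chosen cleavage: [L] and [t] range over all functors
     (F,H) |-> (l F, H[ls_F]) and transformations H[ls_F] -> H given by some
     choice of cartesian lifts. *)
  sharp_lift : forall F G H X (l : Functor F G) (r : Functor F X)
      (r' : Functor G X) (ls : NatTrans (r' \oF l) r) (h : Functor H X)
      (L : Functor (Pullback r h) (Pullback r' h))
      (t : NatTrans (pbpr2 \oF L) pbpr2),
    rule l -> rule r -> rule r' -> policy ls -> rule h -> fibration h ->
    pbpr1 \oF L =F l \oF pbpr1 ->
    (forall z : Pullback r h,
       eqhom (fmap h (t z)) (ls (pb1 z)) /\ cartesian h (t z)) ->
    rule L /\ policy t;
  sharp_oplift : forall F G H X (l : Functor F G) (r : Functor F X)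
      (r' : Functor G X) (ls : NatTrans r (r' \oF l)) (h : Functor H X)
      (L : Functor (Pullback r h) (Pullback r' h))
      (t : NatTrans pbpr2 (pbpr2 \oF L)),
    rule l -> rule r -> rule r' -> policy ls -> rule h -> opfibration h ->
    pbpr1 \oF L =F l \oF pbpr1 ->
    (forall z : Pullback r h,
       eqhom (fmap h (t z)) (ls (pb1 z)) /\ opcartesian h (t z)) ->
    rule L /\ policy t }.
Arguments rule {ctx} T {C D} F : rename.
Arguments policy {ctx} T {C D F G} t : rename.

Definition judgement (ctx : Category) (T : JudgementalTheory ctx)
    (C : Category) (F : Functor C ctx) : Prop := rule T F.

Definition theory_incl (ctx : Category) (S T : JudgementalTheory ctx) : Prop :=
  (forall C D (F : Functor C D), rule S F -> rule T F) /\
  (forall C D (F G : Functor C D) (t : NatTrans F G), policy S t -> policy T t).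

Definition FinSetCat : Category :=
  @MkCategory finType (fun A B => A -> B) (fun A x => x)
    (fun A B C g f x => g (f x))
    (fun _ _ _ => erefl) (fun _ _ _ => erefl) (fun _ _ _ _ _ _ _ => erefl).

(* Fibres are (pre)ordered since [p] is faithful, so that universal properties
   in the fibres need no uniqueness clause.  Implication is contravariant in its
   first variable along vertical arrows; as a functor over the base it is
   therefore defined on cartesian arrows in that variable, where evaluation and
   transposition are natural. *)
Record PropClassifier := MkPropClassifier {
  PP : Category;
  pp : Functor PP FinSetCat;
  pp_faithful : faithful pp;
  pp_fibration : fibration pp;

  meet : Functor (Pullback pp pp) PP;
  meet_over : pp \oF meet =F pp \oF pbpr1;
  meet_cart : preserves_cartesian (pp \oF pbpr1) pp meet;
  meet_pr1 : NatTrans meet pbpr1;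
  meet_pr2 : NatTrans meet pbpr2;
  meet_pr1_vert : vertical_nt pp meet_pr1;
  meet_pr2_vert : vertical_nt pp meet_pr2;
  meet_glb : forall (c : PP) (z : Pullback pp pp),
    fibre_le pp c (pb1 z) -> fibre_le pp c (pb2 z) -> fibre_le pp c (meet z);

  top : Functor FinSetCat PP;
  top_over : pp \oF top =F fid FinSetCat;
  top_cart : preserves_cartesian (fid FinSetCat) pp top;
  top_bang : NatTrans (fid PP) (top \oF pp);
  top_bang_vert : vertical_nt pp top_bang;

  bot : Functor FinSetCat PP;
  bot_over : pp \oF bot =F fid FinSetCat;
  bot_cart : preserves_cartesian (fid FinSetCat) pp bot;
  bot_init : NatTrans (bot \oF pp) (fid PP);
  bot_init_vert : vertical_nt pp bot_init;

  imp : Functor (Pullback (pp \oF cart_incl pp) pp) PP;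
  imp_over : pp \oF imp =F pp \oF (cart_incl pp \oF pbpr1);
  imp_cart : preserves_cartesian (pp \oF cart_incl pp \oF pbpr1) pp imp;
  imp_ev : NatTrans (meet \oF pb_pair imp (cart_incl pp \oF pbpr1) imp_over)
                    pbpr2;
  imp_ev_vert : vertical_nt pp imp_ev;
  imp_adj : forall (c : PP) (z : Pullback (pp \oF cart_incl pp) pp)
      (e : pp c = pp (pb1 z)),
    fibre_le pp (meet (MkPbOb (F := pp) (G := pp) c (pb1 z) e)) (pb2 z) ->
    fibre_le pp c (imp z) }.

(* [T] contains the classifier, the operators, and the natural maps attached to
   their universal properties (in [pairing], [t] is the pairing of its two
   composites with the projections; in [transpose], [t] is the transpose of
   [s], which is unique by faithfulness). *)
Record contains_connectives (D : PropClassifier) (T : JudgementalTheory FinSetCat)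
  : Prop := MkContains {
  has_pp : judgement T (pp D);
  has_meet : rule T (meet D);
  has_meet_pr1 : policy T (meet_pr1 D);
  has_meet_pr2 : policy T (meet_pr2 D);
  has_pairing : forall Q (c : Functor Q (PP D))
      (U : Functor Q (Pullback (pp D) (pp D))) (t : NatTrans c (meet D \oF U)),
    rule T U -> vertical_nt (pp D) t ->
    policy T (nt_comp (whiskR (meet_pr1 D) U) t) ->
    policy T (nt_comp (whiskR (meet_pr2 D) U) t) ->
    policy T t;
  has_top : rule T (top D);
  has_top_bang : policy T (top_bang D);
  has_bot : rule T (bot D);
  has_bot_init : policy T (bot_init D);
  has_cart_incl : rule T (cart_incl (pp D));
  has_imp : rule T (imp D);
  has_imp_ev : policy T (imp_ev D);
  has_transpose : forall Q
      (U : Functor Q (Pullback (pp D \oF cart_incl (pp D)) (pp D)))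
      (V : Functor Q (Pullback (pp D) (pp D)))
      (s : NatTrans (meet D \oF V) (pbpr2 \oF U))
      (t : NatTrans (pbpr1 \oF V) (imp D \oF U)),
    rule T U -> rule T V ->
    pbpr2 \oF V =F cart_incl (pp D) \oF pbpr1 \oF U ->
    policy T s -> vertical_nt (pp D) s -> vertical_nt (pp D) t ->
    policy T t }.

(* Substitutionality is imposed on the generators: [pp] is a fibration and the
   operators preserve cartesian arrows ([meet_cart], [top_cart], [bot_cart],
   [imp_cart]), while the policies produced by [sharp_lift] have cartesian
   components by construction.  It cannot be imposed on every rule and policy
   of the closure under finite limits: the equalizer of dom, cod : ctx^2 -> ctx
   is not fibred over ctx, and the components of [meet_pr1] are vertical, hence
   cartesian only when they are isomorphisms. *)
Record NDT := MkNDT {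
  nd_classifier :> PropClassifier;
  nd_theory : JudgementalTheory FinSetCat;
  nd_contains : contains_connectives nd_classifier nd_theory;
  nd_generated : forall T : JudgementalTheory FinSetCat,
    contains_connectives nd_classifier T -> theory_incl nd_theory T }.

Section Entailment.
Variables (P B : Category) (p : Functor P B).

Definition Entail : Category := Pullback (idarr B) (arrmap p).
Definition ent_e : Functor Entail B := pbpr1.
Definition ent_d : Functor Entail P := adom \oF pbpr2.
Definition ent_c : Functor Entail P := acod \oF pbpr2.

Lemma ent_e_d : ent_e =F p \oF ent_d.
Proof. by move=> a b [uv h]; exact: (eqhom_fmap adom h). Qed.

Lemma ent_e_c : ent_e =F p \oF ent_c.
Proof. by move=> a b [uv h]; exact: (eqhom_fmap acod h). Qed.

Lemma ent_d_c : p \oF ent_d =F p \oF ent_c.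
Proof. by move=> a b f; rewrite /eqhom -(ent_e_d f) -(ent_e_c f). Qed.

End Entailment.

Arguments ent_e {P B} p.
Arguments ent_d {P B} p.
Arguments ent_c {P B} p.

Section Sequents.
Variable D : PropClassifier.

Definition Formulas2 : Category := Pullback (pp D) (pp D).

Lemma meet_pr2_over : pp D \oF meet D =F pp D \oF pbpr2.
Proof.
by move=> a b f; rewrite /eqhom (meet_over f) (pb_square f).
Qed.

(* (gamma, psi) |-> (gamma /\ psi) /\ psi *)
Definition meet_twice : Functor Formulas2 (PP D) :=
  meet D \oF pb_pair (meet D) pbpr2 meet_pr2_over.

(* (gamma -> phi) |-> gamma /\ phi *)
Definition meet_dc : Functor (Entail (pp D)) (PP D) :=
  meet D \oF pb_pair (ent_d (pp D)) (ent_c (pp D)) (ent_d_c (p := pp D)).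

(* Tuples (gamma, psi, gamma /\ psi -> phi). *)
Definition EntailMeet : Category := Pullback (meet D) (ent_d (pp D)).

(* Tuples (gamma, psi, (gamma /\ psi) /\ psi -> phi). *)
Definition EntailMeetTwice : Category := Pullback meet_twice (ent_d (pp D)).

(* Tuples (gamma -> phi, psi) over one object of the base. *)
Definition EntailFormula : Category := Pullback (ent_e (pp D)) (pp D).

Lemma weaken_over :
  pp D \oF (ent_d (pp D) \oF pbpr1) =F
  pp D \oF (@pbpr2 _ _ _ (ent_e (pp D)) (pp D)).
Proof.
move=> a b f.
by rewrite /eqhom -(ent_e_d (fmap pbpr1 f)) (pb_square f).
Qed.

(* (gamma -> phi, psi) |-> gamma /\ psi *)
Definition meet_weaken : Functor EntailFormula (PP D) :=
  meet D \oF pb_pair (ent_d (pp D) \oF pbpr1) pbpr2 weaken_over.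

(* Tuples (gamma -> phi, gamma /\ phi -> psi). *)
Definition EntailCut : Category := Pullback meet_dc (ent_d (pp D)).

End Sequents.

(* Main.v *)
(* For a fixed domain Q, say that U derives V when some vertical policy goes from
   U to V.  This is a preorder on functors Q -> P, stable under restriction along
   rules, and faithfulness of p makes the fibrewise meet a greatest lower bound
   for it.  By the universal properties of the arrow category and of the pullback
   defining the entailment classifier, a derivation of V from U is a rule Q -> E
   with domain U and codomain V.  Each structural rule is thus an inequality in a
   meet-semilattice preorder. *)
From mathcomp Require Import all_boot.
From Stdlib Require Import FunctionalExtensionality ProofIrrelevance.
From Stdlib Require Import ClassicalEpsilon.
Require Import Defs.

Set Implicit Arguments.
Unset Strict Implicit.
Unset Printing Implicit Defensive.
Local Obligation Tactic := idtac.
Local Open Scope cat_scope.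

(** * Strict equality of functors and transport along it *)

Lemma Feq_eq (C D : Category) (F G : Functor C D) : F =F G -> F = G.
Proof.
case: F G => [fo fm fi fc] [go gm gi gc] e.
have eo : fo = go by apply: functional_extensionality_dep; exact: (Feq_ob e).
subst go.
have em : fm = gm.
  apply: functional_extensionality_dep => a.
  apply: functional_extensionality_dep => b.
  apply: functional_extensionality_dep => f.
  exact: eqhom_eq (e a b f).
subst gm.
by rewrite (proof_irrelevance _ fi gi) (proof_irrelevance _ fc gc).
Qed.

Lemma Feq_sym (C D : Category) (F G : Functor C D) : F =F G -> G =F F.
Proof. by move=> e a b f; symmetry; exact: e. Qed.

Lemma NatTrans_ext (C D : Category) (F G : Functor C D) (s t : NatTrans F G) :
  (forall a, s a = t a) -> s = t.
Proof.
case: s t => [s hs] [t ht] /= e.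
have es : s = t by exact: functional_extensionality_dep e.
by subst t; rewrite (proof_irrelevance _ hs ht).
Qed.

(** Commutativity of a square is a proposition, so once the endpoints are identified only the two
    components of a morphism matter. *)
Lemma eqhom_ArrowCat (C : Category) (f g f' g' : ArrowCat C)
    (s : Hom f g) (s' : Hom f' g') :
  f = f' -> g = g' ->
  eqhom (sval s).1 (sval s').1 -> eqhom (sval s).2 (sval s').2 -> eqhom s s'.
Proof.
move=> ef eg; subst f' g' => /eqhom_eq e1 /eqhom_eq e2.
suff -> : s = s' by [].
apply: sig_eq; move: e1 e2.
by case: (sval s) (sval s') => [u v] [u' v'] /= -> ->.
Qed.

Lemma rule_Feq (ctx : Category) (T : JudgementalTheory ctx) (C D : Category)
    (F G : Functor C D) : F =F G -> rule T F -> rule T G.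
Proof. by move=> /Feq_eq ->. Qed.

(** The closure axioms yield composites that differ from the intended functors by a strict equality,
    often merely a reassociation; [Feq_eq] lets the policy be carried across. *)
Lemma policy_eqhom (ctx : Category) (T : JudgementalTheory ctx)
    (C D : Category) (F G F' G' : Functor C D)
    (t : NatTrans F G) (t' : NatTrans F' G') :
  F =F F' -> G =F G' -> (forall a, eqhom (t a) (t' a)) ->
  policy T t -> policy T t'.
Proof.
move=> /Feq_eq eF /Feq_eq eG; subst F' G' => e.
suff -> : t = t' by [].
by apply: NatTrans_ext => a; exact: eqhom_eq.
Qed.

(** * Rules induced by pullbacks and arrow categories *)

Lemma rule_pb_pair (ctx : Category) (T : JudgementalTheory ctx)
    (A B X Q : Category) (F : Functor A X) (G : Functor B X)
    (U : Functor Q A) (V : Functor Q B) (h : F \oF U =F G \oF V) :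
  rule T F -> rule T G -> rule T U -> rule T V -> rule T (pb_pair U V h).
Proof.
move=> rF rG rU rV; apply: pb_ind => //.
- by apply: rule_Feq rU => a b f.
- by apply: rule_Feq rV => a b f.
Qed.

Program Definition arrow_of_nt (Q C : Category) (U V : Functor Q C)
    (t : NatTrans U V) : Functor Q (ArrowCat C) :=
  @MkFunctor Q (ArrowCat C) (fun q => MkArrow (t q))
    (fun _ _ f => exist _ (fmap U f, fmap V f) _) _ _.
Next Obligation. by move=> Q C U V t a b f /=; rewrite -nt_natural. Qed.
Next Obligation. by move=> Q C U V t a; apply: sig_eq; rewrite /= !fmap_id. Qed.
Next Obligation.
by move=> Q C U V t a b c g f; apply: sig_eq; rewrite /= !fmap_comp.
Qed.

(** Whiskering the tautological transformation with [arrow_of_nt t] gives back [t], so [arr_ind]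
    applies. *)
Lemma rule_arrow_of_nt (ctx : Category) (T : JudgementalTheory ctx)
    (Q C : Category) (U V : Functor Q C) (t : NatTrans U V) :
  policy T t -> rule T (arrow_of_nt t).
Proof.
by move=> pt; apply: arr_ind; apply: policy_eqhom pt => // a b f.
Qed.

Lemma rule_idarr (ctx : Category) (T : JudgementalTheory ctx) (C : Category) :
  rule T (fid C) -> rule T (idarr C).
Proof.
move=> /policy_id pC; apply: arr_ind.
by apply: policy_eqhom pC => // a b f.
Qed.

Lemma rule_arrmap (ctx : Category) (T : JudgementalTheory ctx)
    (C D : Category) (F : Functor C D) : rule T F -> rule T (arrmap F).
Proof.
move=> rF; have [rC _] := rule_id rF.
apply: arr_ind.
by apply: policy_eqhom (policy_whiskL rF (arr_taut rC)) => // a b f.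
Qed.

(** * Vertical arrows and vertical transformations *)

Section Vertical.
Variables (E B : Category) (p : Functor E B).

Lemma vertical_ob (a b : E) (f : Hom a b) : vertical p f -> p a = p b.
Proof. by move=> v; symmetry; exact: (f_equal (@atgt B) v). Qed.

Lemma vertical_id (a : E) : vertical p (idm a).
Proof. by rewrite /vertical fmap_id. Qed.

Lemma eqhom_vertical_l (a b c : E) (g : Hom b c) (f : Hom a b) :
  vertical p g -> eqhom (fmap p (g ∘ f)) (fmap p f).
Proof.
by move=> vg; rewrite fmap_comp -[X in eqhom _ X]comp_idl; apply: eqhom_comp.
Qed.

Lemma eqhom_vertical_r (a b c : E) (g : Hom b c) (f : Hom a b) :
  vertical p f -> eqhom (fmap p (g ∘ f)) (fmap p g).
Proof.
move=> vf; rewrite fmap_comp -[X in eqhom _ X]comp_idr; apply: eqhom_comp => //.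
by rewrite /eqhom vf (vertical_ob vf).
Qed.

Lemma vertical_comp (a b c : E) (g : Hom b c) (f : Hom a b) :
  vertical p g -> vertical p f -> vertical p (g ∘ f).
Proof.
by move=> vg vf; rewrite /vertical /eqhom (eqhom_vertical_l f vg); exact: vf.
Qed.

(** The vertical sides of a naturality square disappear under [p], leaving equal images of the other
    two sides. *)
Lemma vertical_nt_Feq (Q : Category) (U V : Functor Q E) (t : NatTrans U V) :
  vertical_nt p t -> p \oF U =F p \oF V.
Proof.
move=> vt a b f.
by rewrite /eqhom -(eqhom_vertical_l _ (vt b)) nt_natural; exact: eqhom_vertical_r.
Qed.

Lemma vertical_unique (a b : E) (f g : Hom a b) :
  faithful p -> vertical p f -> vertical p g -> f = g.
Proof. by move=> fp vf vg; apply: fp; apply: eqhom_eq; rewrite /eqhom vf vg. Qed.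

(** Naturality is automatic: both paths around the square have the same image under the faithful
    [p]. Choice is needed because [fibre_le] only asserts existence. *)
Lemma vertical_family_nt (Q : Category) (U V : Functor Q E) :
  faithful p -> p \oF U =F p \oF V ->
  (forall q, fibre_le p (U q) (V q)) ->
  exists t : NatTrans U V, vertical_nt p t.
Proof.
move=> fp e le.
pose t q := proj1_sig (constructive_indefinite_description _ (le q)).
have vt q : vertical p (t q).
  exact: proj2_sig (constructive_indefinite_description _ (le q)).
suff nat a b (f : Hom a b) : t b ∘ fmap U f = fmap V f ∘ t a.
  by exists (MkNatTrans nat).
apply: fp; apply: eqhom_eq.
by rewrite /eqhom (eqhom_vertical_l _ (vt b)) (eqhom_vertical_r _ (vt a)); exact: e.
Qed.

End Vertical.

(** * The derivability preorder and the entailment classifier *)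

Section Derivations.
Variables (D : PropClassifier) (T : JudgementalTheory FinSetCat).
Hypothesis conn : contains_connectives D T.
Let p := pp D.

Definition derives (Q : Category) (U V : Functor Q (PP D)) : Prop :=
  exists t : NatTrans U V, vertical_nt p t /\ policy T t.

Lemma derives_Feq (Q : Category) (U V : Functor Q (PP D)) :
  rule T U -> U =F V -> derives U V.
Proof.
move=> rU /Feq_eq <-; exists (nt_id U); split; last exact: policy_id.
by move=> q; exact: vertical_id.
Qed.

Lemma derives_trans (Q : Category) (V U W : Functor Q (PP D)) :
  derives U V -> derives V W -> derives U W.
Proof.
move=> [s [vs ps]] [t [vt pt]]; exists (nt_comp t s); split.
- by move=> q; exact: vertical_comp.
- exact: policy_comp.
Qed.

Lemma derives_restrict (Q Q' : Category) (U V : Functor Q (PP D))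
    (K : Functor Q' Q) : rule T K -> derives U V -> derives (U \oF K) (V \oF K).
Proof.
move=> rK [t [vt pt]]; exists (whiskR t K); split; last exact: policy_whiskR.
by move=> q; exact: vt.
Qed.

Lemma derives_meet1 : derives (meet D) pbpr1.
Proof.
by exists (meet_pr1 D); split; [exact: meet_pr1_vert | exact: has_meet_pr1].
Qed.

Lemma derives_meet2 : derives (meet D) pbpr2.
Proof.
by exists (meet_pr2 D); split; [exact: meet_pr2_vert | exact: has_meet_pr2].
Qed.

(** [meet_glb] gives the inequality object by object, and [vertical_family_nt] assembles a
    transformation. By uniqueness of vertical arrows its composites with the projections are the
    given policies, so [has_pairing] makes it a policy. *)
Lemma derives_glb (Q : Category) (C : Functor Q (PP D))
    (U : Functor Q (Formulas2 D)) :
  rule T U -> derives C (pbpr1 \oF U) -> derives C (pbpr2 \oF U) ->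
  derives C (meet D \oF U).
Proof.
move=> rU [s1 [v1 p1]] [s2 [v2 p2]].
have e : p \oF C =F p \oF (meet D \oF U).
  move=> a b f; rewrite /eqhom (vertical_nt_Feq v1 f).
  by symmetry; exact: (meet_over (fmap U f)).
have le q : fibre_le p (C q) ((meet D \oF U) q).
  by apply: meet_glb; [exists (s1 q) | exists (s2 q)].
have [t vt] := vertical_family_nt (@pp_faithful D) e le.
exists t; split=> //; apply: (has_pairing conn) => //.
- apply: policy_eqhom p1 => // a; congr MkArrow.
  apply: (vertical_unique (@pp_faithful D)) => //.
  by apply: vertical_comp; [exact: meet_pr1_vert | exact: vt].
- apply: policy_eqhom p2 => // a; congr MkArrow.
  apply: (vertical_unique (@pp_faithful D)) => //.
  by apply: vertical_comp; [exact: meet_pr2_vert | exact: vt].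
Qed.

Lemma rule_fid_PP : rule T (fid (PP D)).
Proof. by have [] := rule_id (has_pp conn). Qed.

Lemma rule_Entail_legs : rule T (idarr FinSetCat) /\ rule T (arrmap p).
Proof.
have rp := has_pp conn; split; last exact: rule_arrmap.
by apply: rule_idarr; have [] := rule_id rp.
Qed.

Lemma rule_ent_e : rule T (ent_e p).
Proof. by have [rI ra] := rule_Entail_legs; have [] := pb_proj rI ra. Qed.

Lemma policy_ent_taut : policy T (whiskR ataut (pbpr2 : Functor (Entail p) _)).
Proof.
have [rI ra] := rule_Entail_legs; have [_ r2] := pb_proj rI ra.
exact: (policy_whiskR (arr_taut rule_fid_PP) r2).
Qed.

(** The pullback condition says that [p] sends the arrow classified by an object of [Entail p] to an
    identity. *)
Lemma derives_ent : derives (ent_d p) (ent_c p).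
Proof.
exists (whiskR ataut pbpr2); split; last exact: policy_ent_taut.
move=> s; have e := pb_eq s.
have ex : pb1 s = p (ent_d p s) by exact: (f_equal (@asrc FinSetCat) e).
by apply: Logic.eq_trans (eqhom_id ex); symmetry.
Qed.

Lemma rule_ent_d : rule T (ent_d p).
Proof. by have [] := policy_rules policy_ent_taut. Qed.

Lemma rule_ent_c : rule T (ent_c p).
Proof. by have [] := policy_rules policy_ent_taut. Qed.

(** A policy is a rule into the arrow category; verticality is exactly what makes it factor through
    the pullback along [idarr]. *)
Lemma derives_rule (Q : Category) (U V : Functor Q (PP D)) :
  derives U V ->
  exists S : Functor Q (Entail p),
    rule T S /\ ent_d p \oF S =F U /\ ent_c p \oF S =F V.
Proof.
move=> [t [vt pt]].
have [rU _] := policy_rules pt.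
have h : idarr FinSetCat \oF (p \oF U) =F arrmap p \oF arrow_of_nt t.
  move=> a b f; apply: eqhom_ArrowCat => /=.
  - by symmetry; exact: vt.
  - by symmetry; exact: vt.
  - by [].
  - exact: (vertical_nt_Feq vt f).
have [rI ra] := rule_Entail_legs.
exists (pb_pair _ _ h); split=> //.
apply: rule_pb_pair => //; last exact: rule_arrow_of_nt.
by apply: rule_comp => //; exact: (has_pp conn).
Qed.

End Derivations.

Theorem mainTheorem12 (N : NDT) :
  let p := pp N in
  let T := nd_theory N in
  (* (H) gamma /\ phi -> phi *)
  (forall (x : FinSetCat) (gamma phi : PP N)
      (hgamma : p gamma = x) (hphi : p phi = x),
    exists s : Entail p,
      ent_e p s = x /\
      ent_d p s = meet N (MkPbOb (F := p) (G := p) gamma phi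
                            (Logic.eq_trans hgamma (Logic.eq_sym hphi))) /\
      ent_c p s = phi) /\
  (* (Sw) (gamma, delta, gamma /\ delta -> phi)
          |-> (delta, gamma, delta /\ gamma -> phi) *)
  (exists Sw : Functor (EntailMeet N) (EntailMeet N),
    rule T Sw /\
    pbpr1 \oF (pbpr1 \oF Sw) =F pbpr2 \oF pbpr1 /\
    pbpr2 \oF (pbpr1 \oF Sw) =F pbpr1 \oF pbpr1 /\
    ent_c p \oF (pbpr2 \oF Sw) =F ent_c p \oF pbpr2) /\
  (* (C) (gamma, psi, (gamma /\ psi) /\ psi -> phi)
         |-> (gamma, psi, gamma /\ psi -> phi) *)
  (exists Co : Functor (EntailMeetTwice N) (EntailMeet N),
    rule T Co /\
    pbpr1 \oF Co =F pbpr1 /\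
    ent_c p \oF (pbpr2 \oF Co) =F ent_c p \oF pbpr2) /\
  (* (W) (gamma -> phi, psi) |-> (gamma /\ psi -> phi) *)
  (exists We : Functor (EntailFormula N) (Entail p),
    rule T We /\
    ent_d p \oF We =F meet_weaken N /\
    ent_c p \oF We =F ent_c p \oF pbpr1) /\
  (* (Cut) (gamma -> phi, gamma /\ phi -> psi) |-> (gamma -> psi) *)
  (exists Cut : Functor (EntailCut N) (Entail p),
    rule T Cut /\
    ent_d p \oF Cut =F ent_d p \oF pbpr1 /\
    ent_c p \oF Cut =F ent_c p \oF pbpr2).
Proof.
move=> p T; have conn : contains_connectives N T := nd_contains N.
have rp := has_pp conn; have rm := has_meet conn.
have rd := rule_ent_d conn; have rc := rule_ent_c conn.
have re := rule_ent_e conn; have [r1 r2] := pb_proj rp rp.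
have [rEM1 rEM2] := pb_proj rm rd.
split; [|split; [|split; [|split]]].
- move=> x gamma phi hgamma hphi.
  set z := MkPbOb gamma phi _.
  have e : idarr FinSetCat x = arrmap p (MkArrow (meet_pr2 N z)).
    have ex : x = p (meet N z).
      by rewrite -hgamma; symmetry; exact: (Feq_ob (@meet_over N) z).
    by rewrite ex; symmetry; exact: (meet_pr2_vert z).
  by exists (MkPbOb (F := idarr FinSetCat) (G := arrmap p) x _ e).
- pose swap := pb_pair pbpr2 pbpr1 (Feq_sym (@pb_square _ _ _ p p)).
  have rs : rule T swap by exact: rule_pb_pair.
  (* Symmetry of the meet: its two projections, taken in the opposite order. The identity functor
     only puts the target in the shape required by [derives_glb]. *)
  have le_swap : derives T (meet N \oF swap) (meet N).
    apply: (derives_trans (V := meet N \oF fid (Formulas2 N))).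
      apply: (derives_glb conn).
      + by have [] := rule_id rm.
      + apply: (derives_trans (V := pbpr2 \oF swap)).
          exact: derives_restrict rs (derives_meet2 conn).
        by apply: derives_Feq; first exact: rule_comp.
      + apply: (derives_trans (V := pbpr1 \oF swap)).
          exact: derives_restrict rs (derives_meet1 conn).
        by apply: derives_Feq; first exact: rule_comp.
    apply: derives_Feq => //; apply: rule_comp => //.
    by have [] := rule_id rm.
  have le : derives T (meet N \oF swap \oF pbpr1)
                      (ent_c p \oF (pbpr2 : Functor (EntailMeet N) _)).
    apply: (derives_trans (derives_restrict rEM1 le_swap)).
    apply: (derives_trans (V := ent_d p \oF pbpr2)).
      by apply: derives_Feq; [exact: rule_comp | exact: pb_square].
    exact: derives_restrict rEM2 (derives_ent conn).
  have [S [rS [dS cS]]] := derives_rule conn le.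
  (* The swapped formulas and the new derivation form a cone over [EntailMeet]. *)
  have h : meet N \oF (swap \oF pbpr1) =F ent_d p \oF S.
    by move=> a b f; rewrite /eqhom (dS a b f).
  exists (pb_pair _ _ h); split; last by split; [|split].
  by apply: rule_pb_pair => //; exact: rule_comp.
- have rpair : rule T (pb_pair (meet N) pbpr2 (@meet_pr2_over N)).
    exact: rule_pb_pair.
  have rmt : rule T (meet_twice N) by exact: rule_comp.
  have [rM1 rM2] := pb_proj rmt rd.
  (* Duplication of the last formula pairs the identity with the second projection. *)
  have le_dup : derives T (meet N) (meet_twice N).
    apply: (derives_glb conn) => //; first exact: derives_Feq.
    exact: derives_trans (derives_meet2 conn) (derives_Feq r2 _).
  have le : derives T (meet N \oF pbpr1)
                      (ent_c p \oF (pbpr2 : Functor (EntailMeetTwice N) _)).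
    apply: (derives_trans (derives_restrict rM1 le_dup)).
    apply: (derives_trans (V := ent_d p \oF pbpr2)).
      by apply: derives_Feq; [exact: rule_comp | exact: pb_square].
    exact: derives_restrict rM2 (derives_ent conn).
  have [S [rS [dS cS]]] := derives_rule conn le.
  exists (pb_pair _ _ (Feq_sym dS)); split; last by split.
  exact: rule_pb_pair.
- have [rF1 rF2] := pb_proj re rp.
  have rpair : rule T (pb_pair _ _ (@weaken_over N)).
    by apply: rule_pb_pair => //; exact: rule_comp.
  apply: (derives_rule conn).
  (* Weakening precomposes the given derivation with the first projection. *)
  apply: (derives_trans (derives_restrict rpair (derives_meet1 conn))).
  apply: (derives_trans (V := ent_d p \oF pbpr1)).
    by apply: derives_Feq; first exact: rule_comp.
  exact: derives_restrict rF1 (derives_ent conn).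
- have rpair : rule T (pb_pair _ _ (ent_d_c (p := p))) by exact: rule_pb_pair.
  have rmdc : rule T (meet_dc N) by exact: rule_comp.
  have [rC1 rC2] := pb_proj rmdc rd.
  (* The first premise, paired with the identity, gives the map from gamma to gamma /\ phi; cut is
     then transitivity with the second premise. *)
  have le_dc : derives T (ent_d p) (meet_dc N).
    apply: (derives_glb conn) => //; first exact: derives_Feq.
    exact: derives_trans (derives_ent conn) (derives_Feq rc _).
  apply: (derives_rule conn).
  apply: (derives_trans (derives_restrict rC1 le_dc)).
  apply: (derives_trans (V := ent_d p \oF pbpr2)).
    by apply: derives_Feq; [exact: rule_comp | exact: pb_square].
  exact: derives_restrict rC2 (derives_ent conn).
Qed.
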